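(* The complex Banach spaces $(\mathbb{C}^2,\|\cdot\|_{\infty})$ and $(\mathbb{C}^3,\|\cdot\|_{\infty})$ have Property P.
   Context: $(\mathbb{C}^n,\|\cdot\|_\infty)$ is $\mathbb{C}^n$ with the supremum norm $\|z\|_\infty=\max_i|z_i|$. Let $X=(\mathbb{C}^n,\|\cdot\|_X)$. The dual $X^*$ is identified with $\mathbb{C}^n$ with norm $\|z\|_{X^*}=\sup\{|\sum_i z_i\overline{w_i}|:\|w\|_X\le 1\}$. For a complex $n\times n$ matrix $A$, $\|A\|_{X\to X^*}=\sup\{\|Ax\|_{X^*}:\|x\|_X\le1\}$, and $\|B\|_{X^*\to X}=\sup\{\|Bx\|_X:\|x\|_{X^*}\le1\}$. Write $A\ge0$ if $A$ is (Hermitian) positive semidefinite. Put $$\gamma(X):=\sup\{\langle A,B\rangle: A\ge 0,\ B\ge 0,\ \|A\|_{X\to X^*}\le1,\ \|B\|_{X^*\to X}\le1\},$$ where $A,B$ range over complex $n\times n$ matrices and $\langle A,B\rangle=\sum_{i,j}a_{ij}\overline{b_{ij}}$ is the Hilbert–Schmidt inner product. The space $X$ has Property P if and only if $\gamma(X)=1$. *)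

(* Defs.v *)
From mathcomp Require Import all_boot all_order all_algebra.
From mathcomp Require Import sesquilinear spectral.
From mathcomp Require Import complex.
From mathcomp Require Import boolp classical_sets reals constructive_ereal ereal.
Import Order.TTheory GRing.Theory Num.Theory.
Import ComplexField ComplexField.Normc.

Set Implicit Arguments.
Unset Strict Implicit.
Unset Printing Implicit Defensive.

Local Open Scope classical_set_scope.
Local Open Scope ring_scope.
Local Open Scope sesquilinear_scope.

(* [normc : R[i] -> R] is the library's real-valued modulus; [`|z|] lives in
   [R[i]]. *)
Record cnorm (R : realType) (n : nat) := CNorm {
  cnorm_fun :> 'cV[R[i]]_n -> R;
  cnormD : forall x y, cnorm_fun (x + y) <= cnorm_fun x + cnorm_fun y;
  cnormZ : forall a x, cnorm_fun (a *: x) = normc a * cnorm_fun x;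
  cnorm0_eq0 : forall x, cnorm_fun x = 0 -> x = 0
}.

Definition linfty_norm (R : realType) (n : nat) (z : 'cV[R[i]]_n) : R :=
  \big[Num.max/0]_(i < n) normc (z i 0).

Section LinftyNorm.
Variables (R : realType) (n : nat).
Implicit Types x y : 'cV[R[i]]_n.

Lemma normc_ge0 (a : R[i]) : 0 <= normc a.
Proof. by case: a => a b; rewrite sqrtr_ge0. Qed.

Lemma linfty_normD x y :
  linfty_norm (x + y) <= linfty_norm x + linfty_norm y.
Proof.
have ge0 z : 0 <= @linfty_norm R n z by exact: bigmax_ge_id.
apply: bigmax_le => [|i _]; first by rewrite addr_ge0.
rewrite mxE (le_trans (le_normcD _ _))// lerD//.
- exact: (le_bigmax _ (fun i => normc (x i 0))).
- exact: (le_bigmax _ (fun i => normc (y i 0))).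
Qed.

Lemma linfty_normZ (a : R[i]) x :
  linfty_norm (a *: x) = normc a * linfty_norm x.
Proof.
rewrite /linfty_norm; elim/big_ind2 : _ => [|u v u' v' -> ->|i _].
- by rewrite mulr0.
- by rewrite maxr_pMr// normc_ge0.
- by rewrite mxE normcM.
Qed.

Lemma linfty_norm0_eq0 x : linfty_norm x = 0 -> x = 0.
Proof.
move=> x0; apply/colP => i; rewrite mxE; apply: eq0_normc.
apply/le_anti; rewrite normc_ge0 andbT -x0.
exact: (le_bigmax _ (fun i => normc (x i 0))).
Qed.

Definition linfty : cnorm R n :=
  CNorm linfty_normD linfty_normZ linfty_norm0_eq0.

End LinftyNorm.

(* Suprema are taken in [\bar R], since [sup] in [R] has a junk value on
   unbounded sets. *)
Section PropertyP.
Variables (R : realType) (n : nat).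
Implicit Types (X : cnorm R n) (A B : 'M[R[i]]_n).

Definition dual_norm X (z : 'cV[R[i]]_n) : \bar R :=
  ereal_sup [set (normc (\sum_i z i 0 * (w i 0)^*))%:E | w in [set w | X w <= 1]].

Definition opnorm_to_dual X A : \bar R :=
  ereal_sup [set dual_norm X (A *m x) | x in [set x | X x <= 1]].

Definition opnorm_from_dual X B : \bar R :=
  ereal_sup [set (X (B *m x))%:E | x in [set x | (dual_norm X x <= 1)%E]].

(* In the order of [R[i]], [0 <= c] means that [c] is real and nonnegative. *)
Definition psdmx A : Prop :=
  A \is hermsymmx /\ forall x : 'cV[R[i]]_n, 0 <= (x^t* *m A *m x) 0 0.

Definition hs_inner A B : R[i] := \sum_i \sum_j A i j * (B i j)^*.

(* The Hilbert-Schmidt product of two positive semidefinite matrices is real,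
   so taking its real part only changes the type. *)
Definition gamma X : \bar R :=
  ereal_sup [set (complex.Re (hs_inner AB.1 AB.2))%:E | AB in
    [set AB : 'M[R[i]]_n * 'M[R[i]]_n |
      [/\ psdmx AB.1, psdmx AB.2,
          (opnorm_to_dual X AB.1 <= 1)%E & (opnorm_from_dual X AB.2 <= 1)%E]]].

Definition property_P X : Prop := gamma X = 1%E.

End PropertyP.

(* Main.v *)
Require Import Defs.
From mathcomp Require Import all_boot all_order all_algebra.
From mathcomp Require Import reals.
From mathcomp Require Import sesquilinear spectral complex.
From mathcomp Require Import constructive_ereal ereal.
Import Order.TTheory GRing.Theory Num.Theory.

(** For [X = (C^n, sup norm)] the constraint on [B] says that its diagonal
    entries have modulus at most [1] (the other entries are then controlled by
    positivity), and the constraint on [A] gives [x^* A x <= 1] for every [x]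
    with entries of modulus at most [1].  Hence [gamma X <= 1] follows once
    every positive semidefinite [B] is dominated by a rank one matrix with the
    same diagonal: there is [x] with [|x_i|^2 = B_ii] and
    [tr (A B) <= x^* A x].  For [n <= 3] this always holds; it reflects the fact
    that the extreme points of the set of [n x n] complex correlation matrices
    have rank [r] with [r^2 <= n], hence rank one.

    Writing [B = V V^*], so that [B] is a sum of rank one matrices [v v^*], it
    suffices to replace two vectors by one ([merge_pair]) and to iterate
    ([merge_all]).  Let [V] be the [n x 2] matrix with columns [v], [w].  The
    equations [(V T V^* )_ii = 0] are [n < 4] linear conditions on a [2 x 2]
    matrix [T], so they have a nonzero solution, which can be chosen Hermitian
    ([herm_diag_congr_kernel]).  Diagonalizing it by a unitary [U] and replacing
    [V] by [V U], which does not change [V V^*], gives real numbers [d_0, d_1],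
    not both zero, with [d_0 |v_i|^2 + d_1 |w_i|^2 = 0] for all [i]
    ([unitary_balance]).  So the squared moduli of [v] and [w] are proportional
    and, leaving aside the case where one of them vanishes, both some multiple of
    [v] and some multiple of [w] have the required moduli; the form does not
    decrease on the better of the two ([merge_proportional]).

    The reverse inequality [gamma X >= 1] is witnessed by the matrix unit
    [A = B = E_00]. *)

Set Implicit Arguments.
Unset Strict Implicit.
Unset Printing Implicit Defensive.

Local Open Scope ring_scope.
Local Open Scope sesquilinear_scope.

(** * Quadratic forms and Gram matrices *)

Section ComplexMatrices.
Variable C : numClosedFieldType.

Definition hform n (A : 'M[C]_n) (x : 'cV[C]_n) : C := (x^t* *m A *m x) 0 0.

Lemma adjmxM m n p (A : 'M[C]_(m, n)) (B : 'M[C]_(n, p)) :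
  (A *m B)^t* = B^t* *m A^t*.
Proof. by rewrite trmx_mul map_mxM. Qed.

Lemma adjmxE m n (A : 'M[C]_(m, n)) i j : A^t* i j = (A j i)^*.
Proof. by rewrite !mxE. Qed.

Lemma row_adj m n (A : 'M[C]_(m, n)) j : row j (A^t*) = (col j A)^t*.
Proof. by apply/rowP => i; rewrite !mxE. Qed.

Lemma hermsymmxE n (A : 'M[C]_n) : (A \is hermsymmx) = (A == A^t*).
Proof. by rewrite is_hermitianmxE expr0 scale1r. Qed.

Lemma mxtrace_hform n (A : 'M[C]_n) (x : 'cV[C]_n) :
  \tr (A *m (x *m x^t*)) = hform A x.
Proof. by rewrite mulmxA mxtrace_mulC mulmxA trace_mx11. Qed.

Lemma gram_diag m n (V : 'M[C]_(m, n)) i :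
  (V *m V^t*) i i = \sum_k `|V i k| ^+ 2.
Proof. by rewrite mxE; apply: eq_bigr => k _; rewrite !mxE normCK. Qed.

(** The spectral theorem, arranged with the diagonalizing unitary on the left so
    that it can be absorbed into [V] in a product [V *m S *m V^t*]. *)
Lemma herm_spectral n (S : 'M[C]_n) : S \is hermsymmx ->
  exists (U : 'M[C]_n) (d : 'rV[C]_n),
    [/\ U *m U^t* = 1%:M, U^t* *m U = 1%:M,
        d \is a mxOver Num.real & S = U *m diag_mx d *m U^t*].
Proof.
move=> hS; have /orthomx_spectralP eS := hermitian_normalmx hS.
have uP := spectral_unitarymx S.
exists ((spectralmx S)^t*), (spectral_diag S); rewrite trmxCK; split.
- exact/mulmx1C/unitarymxP.
- exact/unitarymxP.
- exact: hermitian_spectral_diag_real.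
- by rewrite -invmx_unitary.
Qed.

Lemma hform_col n r (A : 'M[C]_n) (W : 'M[C]_(n, r)) k :
  hform A (col k W) = (W^t* *m A *m W) k k.
Proof.
transitivity ((row k (W^t* *m A) *m col k W) 0 0).
  by rewrite row_mul row_adj.
by rewrite !mxE; apply: eq_bigr => j _; rewrite !mxE.
Qed.

Lemma mxtrace_gram n r (A : 'M[C]_n) (W : 'M[C]_(n, r)) :
  \tr (A *m (W *m W^t*)) = \sum_k hform A (col k W).
Proof.
by rewrite mulmxA mxtrace_mulC mulmxA; apply: eq_bigr => k _; rewrite hform_col.
Qed.

Lemma psd_gram n (B : 'M[C]_n) : B \is hermsymmx ->
  (forall x, 0 <= hform B x) -> exists V : 'M[C]_n, B = V *m V^t*.
Proof.
move=> hB B_ge0; have [U [d [_ UU _ eB]]] := herm_spectral hB.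
have d_ge0 k : 0 <= d 0 k.
  have := B_ge0 (col k U); rewrite hform_col eB !mulmxA UU mul1mx -mulmxA UU.
  by rewrite mulmx1 !mxE eqxx mulr1n.
exists (U *m diag_mx (map_mx sqrtC d)); rewrite adjmxM mulmxA -(mulmxA U).
rewrite eB; congr (_ *m _ *m _); apply/matrixP => i j.
rewrite mul_diag_mx !mxE eq_sym; case: eqP => [->|_]; last first.
  by rewrite rmorph0 mulr0.
by rewrite !mulr1n -normCK -normrX sqrtCK ger0_norm.
Qed.

(** * Balancing the columns of a matrix *)

(** The map sending [T] to the diagonal of [V *m T *m V^t*] is linear from a
    space of dimension [r * r] to one of dimension [n], so it is not injective;
    [G] below is its matrix on vectorized [T]. *)
Lemma diag_congr_kernel n r (V : 'M[C]_(n, r)) : (n < r * r)%N ->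
  exists2 T : 'M[C]_r, T != 0 & forall i, (V *m T *m V^t*) i i = 0.
Proof.
move=> lt_nr.
pose G : 'M[C]_(n, r * r) :=
  \matrix_i mxvec ((row i V)^T *m map_mx Num.conj (row i V)).
have : kermx G^T != 0.
  by rewrite kermx_eq0 /row_free ltn_eqF// (leq_ltn_trans (rank_leq_col _)).
case/rowV0Pn => v /sub_kermxP vG v0; exists (vec_mx v) => [|i].
  by rewrite vec_mx_eq0.
have /(congr1 trmx)/(congr1 (row i)) := vG.
rewrite trmx_mul trmxK trmx0 row0 row_mul rowK -[v]vec_mxK mxvec_dotmul.
move=> /matrixP/(_ 0 0); rewrite [RHS]mxE vec_mxK => <-.
by rewrite -row_mul -map_trmx !mxE; apply: eq_bigr => j _; rewrite !mxE.
Qed.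

(** The solution space is stable under adjunction, so it contains the Hermitian
    matrices [T + T^t*] and, when this vanishes, ['i *: T]. *)
Lemma herm_diag_congr_kernel n r (V : 'M[C]_(n, r)) : (n < r * r)%N ->
  exists S : 'M[C]_r,
    [/\ S \is hermsymmx, S != 0 & forall i, (V *m S *m V^t*) i i = 0].
Proof.
move=> /(diag_congr_kernel V)[T T0 VT].
have VT' i : (V *m T^t* *m V^t*) i i = 0.
  have -> : V *m T^t* *m V^t* = (V *m T *m V^t*)^t*.
    by rewrite !adjmxM trmxCK mulmxA.
  by rewrite adjmxE VT rmorph0.
have [TN|TN] := eqVneq (T + T^t*) 0.
  exists ('i *: T); split => [||i].
  - rewrite hermsymmxE linearZ/= map_mxZ/= conjCi scaleNr.
    by rewrite -scalerN -(addr0_eq TN) opprK.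
  - by rewrite scaler_eq0 negb_or neq0Ci.
  - by rewrite -scalemxAr -scalemxAl mxE VT mulr0.
exists (T + T^t*); split => // [|i].
  by rewrite hermsymmxE linearD/= map_mxD/= trmxCK addrC.
by rewrite mulmxDr mulmxDl mxE VT VT' addr0.
Qed.

(** The rows of squared moduli of [W] are orthogonal to a fixed real vector: for
    [r = 2] this makes the two columns proportional in squared modulus.  The
    vector [d] is the spectrum of a Hermitian [S] for which [V *m S *m V^t*] has
    zero diagonal, and [W] is [V] expressed in an eigenbasis of [S]. *)
Lemma unitary_balance n r (V : 'M[C]_(n, r)) : (n < r * r)%N ->
  exists (W : 'M[C]_(n, r)) (d : 'rV[C]_r),
    [/\ W *m W^t* = V *m V^t*, d \is a mxOver Num.real, d != 0
      & forall i, \sum_k d 0 k * `|W i k| ^+ 2 = 0].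
Proof.
move=> /(herm_diag_congr_kernel V)[S [hS S0 VS]].
have [U [d [UU _ dR eS]]] := herm_spectral hS.
exists (V *m U), d; split => // [||i].
- by rewrite adjmxM mulmxA -(mulmxA V) UU mulmx1.
- by apply: contraNneq S0 => d0; rewrite eS d0 linear0 mulmx0 mul0mx.
rewrite -[RHS](VS i) eS !mulmxA -(mulmxA _ (U^t*)) -adjmxM.
rewrite [RHS]mxE; apply: eq_bigr => k _.
by rewrite adjmxE mul_mx_diag [X in _ = X * _]mxE mulrAC -normCK mulrC.
Qed.

(** * Domination by a rank one matrix with the same diagonal *)

Lemma hformZ n (A : 'M[C]_n) a x : hform A (a *: x) = `|a| ^+ 2 * hform A x.
Proof.
have -> : hform A (a *: x) = (a^* *: x^t* *m A *m (a *: x)) 0 0.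
  congr ((_ *m _ *m _) 0 0); apply/rowP => i; rewrite !mxE; exact: rmorphM.
by rewrite -scalemxAr -!scalemxAl scalerA mxE normCK.
Qed.

Section Psd.
Variables (n : nat) (A : 'M[C]_n).
Hypothesis A_ge0 : forall x, 0 <= hform A x.

(** When [c > 0], the vectors [sqrt (1 + c) v] and [sqrt (1 + 1 / c) w] both have
    the required squared moduli.  The form takes the values [(1 + c) a] and
    [(1 + 1 / c) b] on them, where [a] and [b] are its values on [v] and [w], and
    one of these is at least [a + b] according to whether [b <= c a]. *)
Lemma merge_proportional (v w : 'cV[C]_n) (c : C) : c \is Num.real ->
    (forall i, `|w i 0| ^+ 2 = c * `|v i 0| ^+ 2) ->
  exists2 x : 'cV[C]_n, forall i, `|x i 0| ^+ 2 = `|v i 0| ^+ 2 + `|w i 0| ^+ 2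
    & hform A v + hform A w <= hform A x.
Proof.
move=> cR wv.
have scaled (a : C) (u : 'cV[C]_n) : 0 <= a ->
    (forall i, `|(sqrtC a *: u) i 0| ^+ 2 = a * `|u i 0| ^+ 2) /\
    hform A (sqrtC a *: u) = a * hform A u.
  move=> a0; have sa : `|sqrtC a| ^+ 2 = a by rewrite -normrX sqrtCK ger0_norm.
  by split => [i|]; rewrite ?hformZ ?mxE ?normrM ?exprMn sa.
have w_eq0 : c = 0 -> w = 0.
  move=> c0; apply/colP => i; apply/eqP; rewrite mxE -normr_eq0 -sqrf_eq0.
  by rewrite wv c0 mul0r.
have hform0 : hform A 0 = 0 by rewrite /hform mulmx0 mxE.
(* A negative ratio forces both vectors to vanish. *)
have [c_lt0|c_ge0] := real_ltP cR (real0 C).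
  have v0 : v = 0.
    apply/colP => i; apply/eqP; rewrite mxE -normr_eq0 -sqrf_eq0.
    rewrite eq_le exprn_ge0// andbT -(nmulr_rge0 _ c_lt0) -wv.
    exact: exprn_ge0.
  exists w => [i|]; rewrite v0 ?mxE ?normr0 ?expr0n ?add0r//.
  by rewrite hform0 add0r.
have [wcv|cvw] := real_leP (ger0_real (A_ge0 w))
                           (realM cR (ger0_real (A_ge0 v))).
  have [xi hx] := scaled (1 + c) v (addr_ge0 ler01 c_ge0).
  exists (sqrtC (1 + c) *: v) => [i|]; first by rewrite xi mulrDl mul1r wv.
  by rewrite hx mulrDl mul1r lerD2l.
have c_neq0 : c != 0.
  by apply: contraTneq cvw => c0; rewrite (w_eq0 c0) c0 mul0r hform0 ltxx.
have c_gt0 : 0 < c by rewrite lt_def c_neq0.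
have [|xi hx] := scaled (1 + c^-1) w; first by rewrite addr_ge0 ?invr_ge0.
exists (sqrtC (1 + c^-1) *: w) => [i|].
  by rewrite xi mulrDl mul1r {2}wv mulKf// addrC.
by rewrite hx mulrDl mul1r addrC lerD2l -(ler_pM2l c_gt0) mulVKf// ltW.
Qed.

(** The bound [n < 4] is the dimension count [n < 2 * 2] of [unitary_balance]. *)
Lemma merge_pair (V : 'M[C]_(n, 2)) : (n < 4)%N ->
  exists2 x : 'cV[C]_n, forall i, `|x i 0| ^+ 2 = (V *m V^t*) i i
    & \tr (A *m (V *m V^t*)) <= hform A x.
Proof.
have sum2 (F : 'I_2 -> C) : \sum_k F k = F 0 + F 1.
  by rewrite big_ord_recl big_ord1; congr (_ + F _); apply/val_inj.
move=> /(@unitary_balance n 2 V)[W [d [<- /mxOverP dR d0 dW]]].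
(* The coefficient that one divides by to get the ratio must be nonzero; in the
   first case [col 1 W] serves as the reference vector and the ratio is 0. *)
have [d1|d1] := eqVneq (d 0 1) 0.
  have d00 : d 0 0 != 0.
    apply: contraNneq d0 => d00; apply/eqP/rowP => k.
    rewrite mxE; case: k => [[|[|//]] lt_k].
      by rewrite -[RHS]d00; congr (d 0 _); apply/val_inj.
    by rewrite -[RHS]d1; congr (d 0 _); apply/val_inj.
  have [i|x xi hx] := @merge_proportional (col 1 W) (col 0 W) 0 (real0 C).
    have /eqP := dW i; rewrite sum2 d1 !mul0r addr0 !mxE mulf_eq0 (negPf d00).
    by move/eqP.
  exists x => [i|]; last by rewrite mxtrace_gram sum2 addrC.
  by rewrite xi gram_diag sum2 !mxE addrC.
have [|i|x xi hx] :=
  @merge_proportional (col 0 W) (col 1 W) (- (d 0 0 / d 0 1)).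
- by rewrite realN realM ?realV ?dR.
- have /eqP := dW i; rewrite sum2 !mxE addrC addr_eq0 => /eqP dW'.
  apply: (mulfI d1); rewrite dW' mulNr mulrN [d 0 1 * _]mulrC.
  by rewrite [in RHS]mulrAC divfK.
exists x => [i|]; last by rewrite mxtrace_gram sum2.
by rewrite xi gram_diag sum2 !mxE.
Qed.

(** Induction on the number of columns: merge all columns but the first into one
    vector [y], then merge the first column with [y]. *)
Lemma merge_all r (V : 'M[C]_(n, r)) : (n < 4)%N ->
  exists2 x : 'cV[C]_n, forall i, `|x i 0| ^+ 2 = (V *m V^t*) i i
    & \tr (A *m (V *m V^t*)) <= hform A x.
Proof.
move=> n4; elim: r V => [|r IHr] V.
  exists 0 => [i|]; first by rewrite gram_diag big_ord0 mxE normr0 expr0n.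
  by rewrite mxtrace_gram big_ord0.
have gram_row p q (Vl : 'M[C]_(n, p)) (Vr : 'M[C]_(n, q)) :
    row_mx Vl Vr *m (row_mx Vl Vr)^t* = Vl *m Vl^t* + Vr *m Vr^t*.
  by rewrite tr_row_mx map_col_mx mul_row_col.
rewrite -[V](@hsubmxK _ n 1 r) (gram_row 1%N r).
set v := lsubmx _; set W := rsubmx _.
have [y yi hy] := IHr W; 
have [x xi hx] := merge_pair (row_mx v y : 'M_(n, 1 + 1)) n4.
rewrite (gram_row 1%N 1%N) in xi hx.
exists x => [i|].
  rewrite xi mxE [RHS]mxE; congr (_ + _).
  by rewrite -yi gram_diag big_ord1.
rewrite (le_trans _ hx)// !mulmxDr !mxtraceD lerD2l (le_trans hy)//.
by rewrite mxtrace_hform.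
Qed.

End Psd.

End ComplexMatrices.

(** * The supremum norm *)

Section LinftyGamma.
Variable R : realType.
Local Notation C := R[i].
Local Notation normc := ComplexField.Normc.normc.

Lemma norm_normc (z : C) : `|z| = (normc z)%:C%C.
Proof. by []. Qed.

Lemma linfty_norm_le1 n (x : 'cV[C]_n) :
  linfty_norm x <= 1 <-> forall i, `|x i 0| <= 1.
Proof.
split=> [x1 i|x1].
  rewrite norm_normc lecR (le_trans _ x1)//.
  exact: (le_bigmax _ (fun i => normc (x i 0))).
by apply: bigmax_le => // i _; rewrite -lecR -norm_normc.
Qed.

Lemma hs_innerE n (A B : 'M[C]_n) : B \is hermsymmx ->
  hs_inner A B = \tr (A *m B).
Proof.
rewrite hermsymmxE => /eqP hB; apply: eq_bigr => i _; rewrite mxE.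
by apply: eq_bigr => j _; rewrite {2}hB adjmxE.
Qed.

Lemma dual_norm_delta n (i : 'I_n) :
  (dual_norm (linfty R n) (delta_mx i 0%R) <= 1)%E.
Proof.
apply: ge_ereal_sup => _ [w /= /linfty_norm_le1 w1 <-].
rewrite lee_fin -lecR -norm_normc (bigD1 i)//= big1 ?addr0 => [|j ji].
  by rewrite mxE !eqxx mul1r norm_conjC.
by rewrite mxE (negPf ji) mul0r.
Qed.

Lemma dual_norm_coord n (x : 'cV[C]_n) i :
  ((normc (x i 0%R))%:E <= dual_norm (linfty R n) x)%E.
Proof.
apply: ereal_sup_ubound; exists (delta_mx i 0).
  apply/linfty_norm_le1 => j; rewrite mxE.
  by case: eqP => _ /=; rewrite ?normr1 ?normr0.
congr (normc _)%:E; rewrite (bigD1 i)//= big1 ?addr0 => [|j ji].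
  by rewrite mxE !eqxx rmorph1 mulr1.
by rewrite mxE (negPf ji) rmorph0 mulr0.
Qed.

(** The coordinate vectors lie in the unit ball of the dual, and [B] maps them to
    its columns. *)
Lemma opnorm_from_dual_diag n (B : 'M[C]_n) i :
  (opnorm_from_dual (linfty R n) B <= 1)%E -> `|B i i| <= 1.
Proof.
move=> hB; have : ((linfty_norm (B *m delta_mx i 0)%R)%:E <= 1)%E.
  apply: le_trans hB; apply: ereal_sup_ubound.
  by exists (delta_mx i 0) => //; exact: dual_norm_delta.
by rewrite lee_fin -colE => /linfty_norm_le1/(_ i); rewrite mxE.
Qed.

Lemma opnorm_to_dual_hform n (A : 'M[C]_n) (x : 'cV[C]_n) :
    (opnorm_to_dual (linfty R n) A <= 1)%E -> (forall i, `|x i 0| <= 1) ->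
  `|hform A x| <= 1.
Proof.
move=> hA /linfty_norm_le1 x1.
have -> : hform A x = \sum_i (A *m x) i 0 * (x i 0)^*.
  rewrite /hform -mulmxA mxE; apply: eq_bigr => i _.
  by rewrite adjmxE mulrC.
rewrite norm_normc lecR -lee_fin; apply: le_trans hA.
apply: (@le_trans _ _ (dual_norm (linfty R n) (A *m x)%R)).
  by apply: ereal_sup_ubound; exists x.
by apply: ereal_sup_ubound; exists x.
Qed.

Lemma gamma_linfty_le1 n : (n < 4)%N -> (gamma (linfty R n) <= 1)%E.
Proof.
move=> n4; apply: ge_ereal_sup => _ [[A B] /= [[hA A0] [hB B0] nA nB] <-].
have [V eB] := psd_gram hB B0.
have [x xi hx] := merge_all A0 V n4.
have x1 i : `|x i 0| <= 1.
  rewrite -(@expr_le1 _ 2)// xi -eB.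
  apply: le_trans (opnorm_from_dual_diag i nB); apply: real_ler_norm.
  by rewrite eB -xi realX.
have := opnorm_to_dual_hform nA x1; rewrite ger0_norm; last exact: A0.
rewrite lee_fin hs_innerE// => /(le_trans hx); rewrite -eB.
by rewrite lecE => /andP[].
Qed.

Lemma gamma_linfty_ge1 n : (1 <= gamma (linfty R n.+1))%E.
Proof.
pose E : 'M[C]_n.+1 := delta_mx 0 0.
have Ex (x : 'cV[C]_n.+1) i : (E *m x) i 0 = x 0 0 *+ (i == 0).
  rewrite mxE (bigD1 0)//= big1 => [|j j0].
    by rewrite mxE eqxx andbT addr0 mulr_natl.
  by rewrite mxE (negPf j0) andbF mul0r.
have psdE : psdmx E.
  split=> [|x].
    rewrite hermsymmxE; apply/eqP/matrixP => i j.
    by rewrite adjmxE !mxE andbC rmorph_nat.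
  rewrite -mulmxA mxE (bigD1 0)//= big1 => [|j j0].
    by rewrite addr0 Ex eqxx mulr1n adjmxE mulrC -normCK exprn_ge0.
  by rewrite Ex (negPf j0) mulr0.
apply: ereal_sup_ubound; exists (E, E) => /=; last first.
  congr (_%:E); rewrite /hs_inner (bigD1 0)//= (bigD1 0)//= mxE eqxx/=.
  rewrite !big1 => [|i i0|j j0]; first by rewrite !addr0 mul1r rmorph1.
    by rewrite big1// => j _; rewrite mxE (negPf i0) mul0r.
  by rewrite mxE (negPf j0) mul0r.
split=> //.
  apply: ge_ereal_sup => _ [x /= /linfty_norm_le1 x1 <-].
  apply: ge_ereal_sup => _ [w /= /linfty_norm_le1 w1 <-].
  rewrite lee_fin -lecR -norm_normc (bigD1 0)//= big1 => [|j j0].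
    by rewrite addr0 Ex eqxx mulr1n normrM norm_conjC mulr_ile1.
  by rewrite Ex (negPf j0) mul0r.
apply: ge_ereal_sup => _ [x /= x1 <-].
rewrite lee_fin; apply/linfty_norm_le1 => i; rewrite Ex.
case: eqP => _; last by rewrite normr0.
by rewrite norm_normc lecR -lee_fin (le_trans (dual_norm_coord x 0)).
Qed.

Lemma property_P_linfty n : (n.+1 < 4)%N -> property_P (linfty R n.+1).
Proof.
by move=> n4; apply/le_anti; rewrite gamma_linfty_le1// gamma_linfty_ge1.
Qed.

End LinftyGamma.

Theorem theorem2p7 (R : realType) :
  property_P (linfty R 2) /\ property_P (linfty R 3).
Proof. by split; apply: property_P_linfty. Qed.
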